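(* A class of graphs has bounded treedepth if and only if it is distance-$\infty$ deletion-flat.
   Context: A class $\mathcal{C}$ is distance-$\infty$ deletion-flat if there exist a function $N:\mathbb{N}\to\mathbb{N}$ and a constant $k$ such that for all $m\in\mathbb{N}$, $G\in\mathcal{C}$ and $W\subseteq V(G)$ with $|W|\ge N(m)$ there exist a set $S\subseteq V(G)$ with $|S|\le k$ and a subset $W_\star\subseteq W\setminus S$ with $|W_\star|\ge m$ such that no two distinct vertices of $W_\star$ lie in the same connected component of $G-S$. Treedepth is the standard graph parameter. *)

(* Defs.v *)
From mathcomp Require Import all_boot.

Set Implicit Arguments.
Unset Strict Implicit.
Unset Printing Implicit Defensive.

Record sgraph := SGraph {
  vertex :> finType;
  edge : rel vertex;
  edge_sym : symmetric edge;
  edge_irrefl : irreflexive edge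
}.

Definition graph_class := sgraph -> Prop.

Section RootedForest.
Variable V : finType.

(* A rooted forest on the vertex set V is given by its parent function,
   with p v = None exactly when v is a root. *)
Implicit Types (p : {ffun V -> option V}) (u v : V).

(* Reflexive: every vertex is its own ancestor. *)
Definition ancestor p u v : bool := connect [rel x y | p x == Some y] v u.

Definition rooted_forest p : bool :=
  [forall u, forall v, (p v == Some u) ==> ~~ ancestor p v u].

(* The ancestors of v are the vertices of the path from v to its root, so
   depths and heights count vertices: a single vertex has height 1. *)
Definition depth p v : nat := #|[set u | ancestor p u v]|.
Definition height p : nat := \max_(v : V) depth p v.

End RootedForest.

(* A rooted forest whose ancestor-descendant closure contains G. *)
Definition elimination_forest (G : sgraph) (p : {ffun G -> option G}) : bool :=
  rooted_forest p &&
  [forall u, forall v, edge u v ==> ancestor p u v || ancestor p v u].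

Definition has_elimination_forest (G : sgraph) (d : nat) : bool :=
  [exists p : {ffun G -> option G}, elimination_forest p && (height p == d)].

(* Witness: a Hamiltonian path of the complete graph, rooted at one end. *)
Lemma ex_elimination_forest (G : sgraph) : exists d, has_elimination_forest G d.
Proof.
pose p : {ffun G -> option G} :=
  [ffun v => [pick u : G | (enum_rank u).+1 == enum_rank v :> nat]].
have pP u v : (p v == Some u) = ((enum_rank u).+1 == enum_rank v :> nat).
  rewrite ffunE; case: pickP => [w /eqP Hw | ->] //.
  apply/eqP/eqP => [[<-] //|]; rewrite -Hw => -[] H.
  by congr Some; apply/enum_rank_inj/val_inj.
have anc_le u v : ancestor p u v -> enum_rank u <= enum_rank v.
  case/connectP=> s; elim: s v => [|w s IH] v /=; first by move=> _ ->.
  case/andP; rewrite pP => /eqP Hw /IH{}IH /IH le_uw.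
  by rewrite -Hw ltnW.
have le_anc u v : enum_rank u <= enum_rank v -> ancestor p u v.
  have [n] := ubnP (enum_rank v); elim: n v => // n IH v ltvn.
  rewrite leq_eqVlt => /orP[/eqP/val_inj/enum_rank_inj -> |ltuv].
    exact: connect0.
  have ltw : (enum_rank v).-1 < #|G|.
    by rewrite (leq_ltn_trans (leq_pred _)) ?ltn_ord.
  pose w := enum_val (Ordinal ltw).
  have Hw : (enum_rank w).+1 = enum_rank v.
    by rewrite enum_valK /= (ltn_predK ltuv).
  apply: (@connect_trans _ _ w).
    by apply: connect1; rewrite /= pP Hw.
  by apply: IH; rewrite -Hw in ltvn ltuv.
exists (height p); apply/existsP; exists p; rewrite eqxx andbT; apply/andP; split.
  apply/forallP=> u; apply/forallP=> v; apply/implyP; rewrite pP => /eqP Hu.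
  by apply/negP => /anc_le; rewrite -Hu ltnn.
apply/forallP=> u; apply/forallP=> v; apply/implyP=> _; apply/orP.
by case/orP: (leq_total (enum_rank u) (enum_rank v)) => /le_anc; [left | right].
Qed.

Definition treedepth (G : sgraph) : nat := ex_minn (ex_elimination_forest G).

Definition bounded_treedepth (C : graph_class) : Prop :=
  exists d : nat, forall G : sgraph, C G -> treedepth G <= d.

(* The edge relation of G - S; the vertices of S are kept as isolated points,
   which is harmless when comparing vertices outside S. *)
Definition edge_del (G : sgraph) (S : {set G}) : rel G :=
  [rel x y | [&& x \notin S, y \notin S & edge x y]].

Definition deletion_flat_infty (C : graph_class) : Prop :=
  exists (N : nat -> nat) (k : nat),
    forall (m : nat) (G : sgraph), C G ->
    forall W : {set G}, N m <= #|W| ->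
    exists (S Wstar : {set G}),
      [/\ #|S| <= k, Wstar \subset W :\: S, m <= #|Wstar|
        & {in Wstar &, forall u v, u != v -> ~~ connect (edge_del S) u v}].

(* Main.v *)
Require Import Defs.
From mathcomp Require Import all_boot.

(** If [G] has an elimination forest of height at most [d] and [W] is large,
    then some vertex (or the virtual root above all roots) has [m] children
    whose subtrees meet [W]: delete the at most [d] ancestors of that vertex
    and pick one vertex of [W] below each child.

    Conversely, among the spanning rooted forests of [G] using only edges of
    [G], one maximizing the sum of the depths is an elimination forest: if an
    edge [uv] joined incomparable vertices with [v] not deeper than [u],
    rehanging the subtree of [v] below [u] would increase the sum.  Its
    branches are paths of [G], and deleting [k] vertices from a path leaves at
    most [k + 1] components, so deletion-flatness bounds its height. *)

Set Implicit Arguments.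
Unset Strict Implicit.
Unset Printing Implicit Defensive.

(** * Ancestors and depth in rooted forests *)

Section Ancestors.
Variables (V : finType) (p : {ffun V -> option V}).

Lemma ancestor_refl v : ancestor p v v.
Proof. exact: connect0. Qed.

Lemma ancestor_trans v u w : ancestor p u v -> ancestor p v w -> ancestor p u w.
Proof. by move=> uv vw; apply: connect_trans vw uv. Qed.

Lemma ancestor_step u v :
  ancestor p u v =
  (u == v) || (if p v is Some w then ancestor p u w else false).
Proof.
apply/idP/orP => [/connectP[[|w s] /=]|[/eqP->|]]; last 2 first.
- exact: ancestor_refl.
- case E: (p v) => [w|//] uw; apply: ancestor_trans uw _.
  by apply: connect1; rewrite /= E.
- by move=> _ ->; left.
- move=> /andP[/eqP-> ps] ->; right; apply/connectP; by exists s.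
Qed.

Lemma ancestor_parent u v : p v = Some u -> ancestor p u v.
Proof. by move=> E; rewrite ancestor_step E ancestor_refl orbT. Qed.

Lemma ancestor_ranked (r : V -> nat) :
    (forall u v, p v = Some u -> r u < r v) ->
  forall u v, ancestor p u v -> r u <= r v.
Proof.
move=> rP u v /connectP[s]; elim: s v => [|w s IH] v /=; first by move=> _ ->.
by case/andP=> /eqP /rP ltr /IH{}IH /IH /leq_ltn_trans /(_ ltr) /ltnW.
Qed.

(** A rank that grows strictly from parent to child certifies that there are no cycles. *)
Lemma ranked_forest (r : V -> nat) :
  (forall u v, p v = Some u -> r u < r v) -> rooted_forest p.
Proof.
move=> rP; apply/'forall_forallP => u v; apply/implyP => /eqP /rP ltr.
by apply/negP => /(ancestor_ranked rP); rewrite leqNgt ltr.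
Qed.

Hypothesis forest : rooted_forest p.

Lemma forest_acyclic u v : p v = Some u -> ~~ ancestor p v u.
Proof. by move=> /eqP E; move/'forall_forallP/(_ u v)/implyP: forest; apply. Qed.

Lemma depth_root v : p v = None -> depth p v = 1.
Proof.
move=> E; rewrite -(cards1 v); congr #|pred_of_set _|; apply/setP => u.
by rewrite !inE ancestor_step E orbF.
Qed.

Lemma ancestors_child u v : p v = Some u ->
  [set w | ancestor p w v] = v |: [set w | ancestor p w u].
Proof. by move=> E; apply/setP => w; rewrite !inE ancestor_step E. Qed.

Lemma depth_child u v : p v = Some u -> depth p v = (depth p u).+1.
Proof.
move=> E; rewrite /depth (ancestors_child E) cardsU1 inE.
by rewrite forest_acyclic.
Qed.

Lemma parent_depth_lt u v : p v = Some u -> depth p u < depth p v.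
Proof. by move=> /depth_child->. Qed.

Lemma forest_ind (P : V -> Prop) :
  (forall v, (forall u, p v = Some u -> P u) -> P v) -> forall v, P v.
Proof.
move=> step v; have [n] := ubnP (depth p v).
elim: n v => // n IH v ltn; apply: step => u /parent_depth_lt ltd.
by apply: IH; apply: leq_trans ltd _.
Qed.

Lemma ancestor_total u v w :
  ancestor p u w -> ancestor p v w -> ancestor p u v || ancestor p v u.
Proof.
elim/forest_ind: w => w IH uw vw.
move: (uw) (vw); rewrite (ancestor_step u) (ancestor_step v).
case/orP=> [/eqP->|]; first by rewrite vw orbT.
case E: (p w) => [x|//] ux /orP[/eqP->|vx]; first by rewrite uw.
exact: IH E ux vx.
Qed.

Lemma siblings_ancestor u v : p u = p v -> ancestor p u v -> u = v.
Proof.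
move=> E; rewrite ancestor_step -E; case/orP=> [/eqP //|].
by case Eu: (p u) => [w|//] uw; have := forest_acyclic Eu; rewrite uw.
Qed.

(** The ancestors of [w] form a chain, and comparable siblings coincide. Two roots count as siblings
    here. *)
Lemma siblings_common_descendant u v w :
  p u = p v -> ancestor p u w -> ancestor p v w -> u = v.
Proof.
move=> E uw vw; case/orP: (ancestor_total uw vw).
  exact: siblings_ancestor.
by move=> vu; apply/esym/siblings_ancestor.
Qed.

End Ancestors.

(** * Rehanging a subtree *)

Section Rehang.
Variables (V : finType) (p : {ffun V -> option V}) (u v : V).
Hypothesis forest : rooted_forest p.
Hypothesis vNu : ~~ ancestor p v u.

Definition rehang : {ffun V -> option V} :=
  [ffun x => if x == v then Some u else p x].

Lemma rehang_forest : rooted_forest rehang.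
Proof.
(* Raising the subtree of [v] by the depth of [u] ranks [v] above [u], which lies outside that
   subtree. *)
pose r x := depth p x + (if ancestor p v x then depth p u else 0).
apply: (@ranked_forest _ _ r) => y x; rewrite ffunE /r.
case: eqVneq => [-> [<-]|xv E].
  rewrite (negPf vNu) addn0 ancestor_refl -add1n leq_add2r.
  by apply/card_gt0P; exists v; rewrite inE ancestor_refl.
rewrite (ancestor_step p v x) E eq_sym (negPf xv) /= ltn_add2r.
exact: parent_depth_lt.
Qed.

Hypothesis depth_vu : depth p v <= depth p u.

(** Induction along the new forest: [v] gains at least one by [depth_vu], and every other vertex
    with a parent inherits the bound from it. *)
Lemma rehang_depth x : depth p x + (x == v) <= depth rehang x.
Proof.
elim/(forest_ind rehang_forest): x => x IH.
have E : rehang x = if x == v then Some u else p x by rewrite ffunE.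
case: eqVneq E IH => [-> | xv] E IH.
  rewrite (depth_child rehang_forest E) addn1 ltnS (leq_trans depth_vu) //.
  by apply: leq_trans (IH _ E); rewrite leq_addr.
rewrite addn0; case Ex: (p x) => [y|]; last by rewrite !depth_root ?E.
rewrite (depth_child forest Ex) (depth_child rehang_forest (etrans E Ex)) ltnS.
by apply: leq_trans (IH _ (etrans E Ex)); rewrite leq_addr.
Qed.

Lemma rehang_sum_depth : \sum_x depth p x < \sum_x depth rehang x.
Proof.
rewrite (bigD1 v) //= [X in _ < X](bigD1 v) //= -addSn leq_add //.
  by have := rehang_depth v; rewrite eqxx addn1.
by apply: leq_sum => x _; apply: leq_trans (rehang_depth x); rewrite leq_addr.
Qed.

End Rehang.

(** * Elimination forests made of edges of the graph *)

Lemma treedepth_le (G : sgraph) (p : {ffun G -> option G}) :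
  elimination_forest p -> treedepth G <= height p.
Proof.
move=> pE; rewrite /treedepth; case: ex_minnP => d _; apply.
by apply/existsP; exists p; rewrite pE eqxx.
Qed.

Definition forest_in (G : sgraph) (p : {ffun G -> option G}) : bool :=
  rooted_forest p && [forall u, forall v, (p v == Some u) ==> edge u v].

Lemma ex_dfs_forest (G : sgraph) :
  exists2 p : {ffun G -> option G}, elimination_forest p & forest_in p.
Proof.
(* The forest of isolated roots shows that there is something to maximize over. *)
have none_in : forest_in [ffun=> None : option G].
  apply/andP; split.
    by apply: (@ranked_forest _ _ (fun=> 0)) => u v; rewrite ffunE.
  by apply/'forall_forallP => u v; rewrite ffunE.
case: (arg_maxnP (fun p : {ffun G -> option G} => \sum_x depth p x) none_in).
move=> p p_in p_max; exists p => //; case/andP: (p_in) => forest p_edge.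
rewrite /elimination_forest forest; apply/'forall_forallP => u v.
apply/implyP; wlog le_vu : u v / depth p v <= depth p u => [th uv|uv].
  case/orP: (leq_total (depth p v) (depth p u)) => le; first exact: th.
  by rewrite orbC; apply: th; rewrite // edge_sym.
case vu: (ancestor p v u); first by rewrite orbT.
have vNu := negbT vu.
suff /p_max : forest_in (rehang p u v).
  by move=> /=; rewrite leqNgt (rehang_sum_depth forest vNu).
rewrite /forest_in rehang_forest //; apply/'forall_forallP => y x.
rewrite ffunE; case: (eqVneq x v) => [->|_].
  by apply/implyP => /eqP[<-].
by move/'forall_forallP: p_edge; apply.
Qed.

(** * Separated vertices on a branch *)

Section Deletion.
Variables (G : sgraph) (S W : {set G}).

Lemma connect_edge_del_in x y : x \in S -> connect (edge_del S) y x -> y = x.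
Proof.
have edgeC : symmetric (edge_del S) by move=> a b; rewrite /edge_del /= andbCA edge_sym.
move=> xS; rewrite (sym_connect_sym edgeC) => /connectP[[|z s] //=].
by rewrite {1}/edge_del /= xS.
Qed.

Hypothesis WS : W \subset ~: S.
Hypothesis separated :
  {in W &, forall u v, u != v -> ~~ connect (edge_del S) u v}.

(* The boolean term records whether [x] itself lies in the component of [G - S]
   of some vertex of [W] above it; otherwise the last piece of the branch is
   still available for a new vertex of [W]. *)
Lemma separated_branch_strong (p : {ffun G -> option G}) : forest_in p ->
  forall x, #|W :&: [set y | ancestor p y x]| <=
    #|S :&: [set y | ancestor p y x]| +
    [exists w in W :&: [set y | ancestor p y x], connect (edge_del S) w x].
Proof.
case/andP=> forest p_edge; elim/(forest_ind forest) => x IH.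
have xW_notS : x \in W -> x \notin S.
  by move/(subsetP WS); rewrite inE.
case Ex: (p x) => [y|]; last first.
  have -> : [set y | ancestor p y x] = [set x].
    by apply/setP=> y; rewrite !inE ancestor_step Ex orbF.
  have [xW | xW] := boolP (x \in W).
    rewrite (leq_trans (subset_leq_card (subsetIr _ _))) // cards1.
    suff -> : [exists w in W :&: [set x], connect (edge_del S) w x] by rewrite addn1.
    by apply/existsP; exists x; rewrite !inE eqxx xW connect0.
  suff -> : W :&: [set x] = set0 by rewrite cards0.
  by apply/setP=> z; rewrite !inE andbC; case: eqP => // ->; apply: negPf.
have edge_yx : edge y x.
  by move/'forall_forallP/(_ y x)/implyP: p_edge; apply; rewrite Ex.
have xNy := forest_acyclic forest Ex.
rewrite (ancestors_child Ex); move/(_ y Ex): IH.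
set A := [set z | ancestor p z y].
have xA : x \notin A by rewrite inE.
have addx (B : {set G}) : #|B :&: (x |: A)| = (x \in B) + #|B :&: A|.
  rewrite setIUr; case xB: (x \in B).
    by rewrite (setIidPr _) ?sub1set // cardsU1 inE (negPf xA) andbF.
  suff -> : B :&: [set x] = set0 by rewrite set0U.
  by apply/setP=> z; rewrite !inE andbC; case: eqP => // ->.
rewrite !addx => IH.
(* A vertex of [S] adds one on the right, which pays for the boolean term of its parent. *)
have [xS | xS] := boolP (x \in S).
  have /negPf-> : x \notin W by apply: contraL xS => /xW_notS.
  rewrite add0n (leq_trans IH) // add1n addSn -addnS leq_add2l.
  exact: leq_trans (leq_b1 _) _.
(* Outside [S], the edge from [y] prolongs the connection to [x]; if [y] were in [S] it would be
   isolated, so [w = y] would lie in both [W] and [S]. *)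
have extend : [exists w in W :&: A, connect (edge_del S) w y] ->
    exists2 w, w \in W :&: A & connect (edge_del S) w x.
  case/exists_inP=> w wWA wy; exists w => //; apply: (connect_trans wy).
  have [yS | yS] := boolP (y \in S); last first.
    by apply: connect1; rewrite /edge_del /= yS xS.
  move: wWA; rewrite (connect_edge_del_in yS wy) inE.
  by case/andP=> /(subsetP WS); rewrite inE yS.
rewrite add0n; have [xW | xW] := boolP (x \in W).
  have -> : [exists w in W :&: (x |: A), connect (edge_del S) w x].
    by apply/existsP; exists x; rewrite !inE eqxx xW connect0.
  rewrite addnC leq_add2r (leq_trans IH) //.
  (* The new vertex [x] of [W] turns the boolean term to 1; were it already 1 at [y], then [x] would
     be connected to another vertex of [W]. *)
  case: (boolP [exists w in _, _]) => [/extend[w]|]; last by rewrite addn0.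
  rewrite inE => /andP[wW wA] wx.
  have wx_neq : w != x by apply: contraNneq xA => <-.
  by have := separated wW xW wx_neq; rewrite wx.
rewrite add0n (leq_trans IH) // leq_add2l.
case: (boolP [exists w in _, _]) => // /extend[w]; rewrite inE => /andP[wW wA] wx.
suff -> : [exists w in W :&: (x |: A), connect (edge_del S) w x] by [].
by apply/existsP; exists w; rewrite in_setI in_setU wW wA orbT.
Qed.

Lemma separated_branch (p : {ffun G -> option G}) : forest_in p ->
  forall x, #|W :&: [set y | ancestor p y x]| <= #|S|.+1.
Proof.
move=> p_in x; apply: leq_trans (separated_branch_strong p_in x) _.
by rewrite -addn1 leq_add ?leq_b1 // subset_leq_card ?subsetIl.
Qed.

End Deletion.

(** * Flatness implies bounded treedepth *)

Lemma flat_bounded_treedepth (C : graph_class) :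
  deletion_flat_infty C -> bounded_treedepth C.
Proof.
(* A longer branch would contain [k + 2] separated vertices, but deleting [k] vertices allows at
   most [k + 1]. *)
case=> N [k flat]; exists (N k.+2) => G CG.
have [p p_elim p_in] := ex_dfs_forest G.
apply: leq_trans (treedepth_le p_elim) _; apply/bigmax_leqP => v _.
(* By definition [depth p v] is the size of the ancestor set of [v], so flatness applies to that
   set. *)
rewrite leqNgt; apply/negP => /ltnW /(flat _ _ CG) [S [W [Sk WD mW sep]]].
have WS : W \subset ~: S by apply: subset_trans WD _; rewrite setDE subsetIr.
have := separated_branch WS sep p_in v.
rewrite (setIidPl _); last by apply: subset_trans WD _; apply: subsetDl.
move=> /(leq_trans mW) kS.
by have := leq_trans kS (Sk : _ < k.+1); rewrite ltnn.
Qed.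

(** * Bounded treedepth implies flatness *)

Section Branching.
Variables (G : sgraph) (p : {ffun G -> option G}) (W : {set G}).
Hypothesis forest : rooted_forest p.

(* The children of [o] with a descendant in [W]; [None] stands for a virtual
   root above all roots. *)
Definition branches (o : option G) : {set G} :=
  [set x | (p x == o) && [exists w in W, ancestor p x w]].

(** Once [j] reaches the height of [p], this contains all of [W]. *)
Definition upper_set (j : nat) : {set G} :=
  [set x | (depth p x <= j) && [exists w in W, ancestor p x w]].

(** Each vertex of [upper_set j.+1] is a branch of the virtual root or of a vertex of [upper_set j],
    hence the factor [n.+1]. *)
Lemma card_upper_set m : (forall o, #|branches o| <= m) ->
  forall j, #|upper_set j| <= iter j (fun n => m * n.+1) 0.
Proof.
move=> le_m; elim=> [|j IH] /=.
  rewrite leqn0 cards_eq0; apply/eqP/setP => x; rewrite !inE leqNgt.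
  suff -> : 0 < depth p x by [].
  by apply/card_gt0P; exists x; rewrite inE ancestor_refl.
pose O : {set option G} := None |: Some @: upper_set j.
have sub : upper_set j.+1 \subset \bigcup_(o in O) branches o.
  apply/subsetP => x; rewrite inE => /andP[xj xW].
  apply/bigcupP; exists (p x); last by rewrite inE eqxx.
  rewrite !inE; case E: (p x) => [y|] //=; apply/imsetP; exists y => //.
  rewrite (depth_child forest E) ltnS in xj; rewrite inE xj.
  case/exists_inP: xW => w wW xw; apply/exists_inP; exists w => //.
  exact: ancestor_trans (ancestor_parent E) xw.
have card_O : #|O| <= (iter j (fun n => m * n.+1) 0).+1.
  rewrite cardsU1 -[in X in _ <= X]add1n leq_add ?leq_b1 //.
  exact: leq_trans (leq_imset_card _ _) IH.
apply: leq_trans (subset_leq_card sub) _.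
have card_cup : #|\bigcup_(o in O) branches o| <= \sum_(o in O) m.
  elim/big_rec2: _ => [|o A n _ le_nA]; first by rewrite cards0.
  by rewrite (leq_trans (leq_card_setU _ _)) // leq_add.
by apply: leq_trans card_cup _; rewrite sum_nat_const mulnC leq_mul2l card_O orbT.
Qed.

(** Proper from the viewpoint of the children of [o]: the vertex [o] itself is included. *)
Definition proper_ancestors (o : option G) : {set G} :=
  if o is Some y then [set z | ancestor p z y] else set0.

Hypothesis closure :
  [forall u, forall v, edge u v ==> ancestor p u v || ancestor p v u].

(** By [closure], an edge leaving the subtree of [x] ends in a proper ancestor of [x], and these are
    deleted. *)
Lemma descendants_edge_del x u v :
  edge_del (proper_ancestors (p x)) u v -> ancestor p x u -> ancestor p x v.
Proof.
case/and3P=> _ vS uv xu.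
move/'forall_forallP/(_ u v)/implyP/(_ uv)/orP: closure => -[].
  exact: ancestor_trans.
move=> vu; case/orP: (ancestor_total forest xu vu) => //.
rewrite ancestor_step => /orP[/eqP->|]; first exact: ancestor_refl.
by move: vS; case: (p x) => [y|//]; rewrite inE => /negPf->.
Qed.

Lemma descendants_connect x u v :
  connect (edge_del (proper_ancestors (p x))) u v ->
  ancestor p x u -> ancestor p x v.
Proof.
case/connectP=> s; elim: s u => [|w s IH] u /=; first by move=> _ ->.
by case/andP=> /descendants_edge_del uw ws vE /uw; apply: IH.
Qed.

Lemma branches_flat o : exists W' : {set G},
  [/\ W' \subset W :\: proper_ancestors o, #|W'| = #|branches o|
    & {in W' &, forall u v, u != v ->
        ~~ connect (edge_del (proper_ancestors o)) u v}].
Proof.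
(* The default is never taken on [branches o]; [f] is injective there since siblings have disjoint
   subtrees. *)
pose f x := odflt x [pick w in W | ancestor p x w].
have fP x : x \in branches o -> [/\ p x = o, f x \in W & ancestor p x (f x)].
  rewrite inE => /andP[/eqP-> /exists_inP[w wW xw]]; rewrite /f.
  case: pickP => [z /andP[zW xz] //|/(_ w)]; by rewrite wW xw.
exists (f @: branches o); split.
- apply/subsetP => _ /imsetP[x /fP[px fW xf] ->]; rewrite inE fW andbT.
  move: px; case: o {fP} => [y|] px; rewrite ?inE //.
  apply: contra (forest_acyclic forest px); exact: ancestor_trans.
- apply: card_in_imset => x y /fP[px _ xf] /fP[py _ yf] fxy.
  by apply: (siblings_common_descendant forest _ xf); rewrite ?px ?fxy.
- move=> _ _ /imsetP[x /fP[px _ xf] ->] /imsetP[y /fP[py _ yf] ->].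
  apply: contraNN; rewrite -px => /descendants_connect /(_ xf) xfy.
  by rewrite (siblings_common_descendant forest _ xfy yf) // px.
Qed.

Lemma card_proper_ancestors o : #|proper_ancestors o| <= height p.
Proof.
case: o => [y|]; last by rewrite cards0.
exact: (leq_bigmax (F := depth p)).
Qed.

End Branching.

Lemma bounded_treedepth_flat (C : graph_class) :
  bounded_treedepth C -> deletion_flat_infty C.
Proof.
(* The iterate bounds [W] when every vertex and the virtual root have fewer than [m] branches; the
   successor makes [W] exceed it. *)
case=> d bound; exists (fun m => (iter d (fun n => m * n.+1) 0).+1), d.
move=> m G CG W largeW; move: (bound G CG); rewrite /treedepth.
case: ex_minnP => h /existsP[p /andP[/andP[forest closure] /eqP <-]] _ hd.
suff /existsP[o mo] : [exists o, m <= #|branches p W o|].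
  have [W' [sub cardW' sep]] := branches_flat W forest closure o.
  exists (proper_ancestors p o), W'; split=> //; last by rewrite cardW'.
  exact: leq_trans (card_proper_ancestors _ _) hd.
apply: contraLR largeW => /existsPn few; rewrite -leqNgt.
have le_m o : #|branches p W o| <= m by have:= few o; rewrite -ltnNge => /ltnW.
apply: leq_trans (card_upper_set forest le_m d); apply: subset_leq_card.
apply/subsetP => w wW; rewrite inE; apply/andP; split.
  by apply: leq_trans hd; apply: (leq_bigmax (F := depth p)).
by apply/exists_inP; exists w; rewrite ?ancestor_refl.
Qed.

Theorem theorem18p27 (C : graph_class) :
  bounded_treedepth C <-> deletion_flat_infty C.
Proof.
split; [exact: bounded_treedepth_flat | exact: flat_bounded_treedepth].
Qed.
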